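(* Let $A,B,C,\alpha_0,\beta_0,\gamma_0$ be real with $C>0$ and $\beta_0>C$, and put $\nu=(\beta_0-C)/C>0$. Let $w(x,t)=\sum_{n,k\ge0}w_{n,k}x^k t^n/n!$ and $W(t)=w(0,t)$ be the generating functions of the affine Motzkin path model, and let $\rho,F_\nu,L_\nu$ be as in the context. Then for all sufficiently small $x>0$ and all $t$ sufficiently close to the origin, $$w(x,t)=\frac{1}{F_\nu(\rho(x))}\int_0^{\rho(x)}L_\nu(v)\,W\big(t+\rho(x)-v\big)\,dv .$$ The right-hand side extends continuously to $x=0$, where it equals $W(t)$. Consequently, the return sequence $(w_{n,0})_{n\ge0}$ together with the affine step weights determines every coefficient $w_{n,k}$.
   Context: Affine weighted Motzkin paths: a path starts at height $0$, never goes below height $0$, and uses steps $k\to k+1$ of weight $\alpha_k=Ak+\alpha_0$, $k\to k$ of weight $\gamma_k=Bk+\gamma_0$, and $k+1\to k$ of weight $\beta_k=Ck+\beta_0$ (down-steps are indexed by their arrival height), for $k\ge0$. The weight of a path is the product of its step weights (the empty path has weight $1$; weights may be negative, giving signed totals). $w_{n,k}$ is the total weight of all such paths of length $n$ ending at height $k$. Put $Q(x)=Ax^2+Bx+C$ and $\delta=\beta_0-C=\nu C$. Let $X$ be the solution near $0$ of $X'(\tau)=Q(X(\tau))$, $X(0)=0$, and let $\rho(x)=X^{-1}(x)=\int_0^x dy/Q(y)$ be its local inverse near $0$. For small $\tau>0$ (where $X(\tau)>0$) define $$F_\nu(\tau)=X(\tau)^\nu\exp\Big(\int_0^\tau\big[(\alpha_0-\nu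 A)X(r)+\gamma_0-\nu B\big]\,dr\Big),\qquad L_\nu(\tau)=\frac{\delta F_\nu(\tau)}{X(\tau)},$$ where $X(\tau)^\nu$ is the positive real power. The series $w(x,t)$ is analytic near the origin. *)

(* Defs.v *)
From Stdlib Require Import Reals List Bool Factorial.
From Coquelicot Require Import Coquelicot.
Import ListNotations.
Open Scope R_scope.

Inductive step := Up | Level | Down.

Fixpoint words (n : nat) : list (list step) :=
  match n with
  | O => [[]]
  | S m => flat_map (fun p => [Up :: p; Level :: p; Down :: p]) (words m)
  end.

(* [path_to k h p]: the word p, started at height h, never goes below 0 and
   ends at height k. *)
Fixpoint path_to (k h : nat) (p : list step) : bool :=
  match p with
  | [] => Nat.eqb h k
  | Up :: q => path_to k (S h) q
  | Level :: q => path_to k h q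
  | Down :: q => match h with O => false | S j => path_to k j q end
  end.

(* Weight of the word p started at height h.  The value 0 for a down-step at
   height 0 is a dummy: such words are rejected by [path_to]. *)
Fixpoint path_weight (alpha gamma beta : nat -> R) (h : nat) (p : list step)
    : R :=
  match p with
  | [] => 1
  | Up :: q => alpha h * path_weight alpha gamma beta (S h) q
  | Level :: q => gamma h * path_weight alpha gamma beta h q
  | Down :: q =>
      match h with
      | O => 0
      | S j => beta j * path_weight alpha gamma beta j q
      end
  end.

Definition total_weight (alpha gamma beta : nat -> R) (n k : nat) : R :=
  fold_right Rplus 0
    (map (path_weight alpha gamma beta 0) (filter (path_to k 0) (words n))).

Definition affine (a b : R) (k : nat) : R := a * INR k + b.

Definition motzkin_weight (A B C alpha0 beta0 gamma0 : R) (n k : nat) : R :=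
  total_weight (affine A alpha0) (affine B gamma0) (affine C beta0) n k.

Definition term (u : nat -> nat -> R) (x t : R) (n k : nat) : R :=
  u n k * x ^ k * t ^ n / INR (fact n).

Definition abs_summable (u : nat -> nat -> R) (x t : R) : Prop :=
  (forall n, ex_series (fun k => Rabs (term u x t n k))) /\
  ex_series (fun n => Series (fun k => Rabs (term u x t n k))).

Definition analytic_at_origin (u : nat -> nat -> R) : Prop :=
  exists r : posreal, forall x t : R,
    Rabs x < r -> Rabs t < r -> abs_summable u x t.

(* The sum of the double series, meaningful where [abs_summable u x t]. *)
Definition gf (u : nat -> nat -> R) (x t : R) : R :=
  Series (fun n => Series (fun k => term u x t n k)).

Definition egf (a : nat -> R) (t : R) : R :=
  Series (fun n => a n * t ^ n / INR (fact n)).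

Definition Q (A B C x : R) : R := A * x ^ 2 + B * x + C.

Definition solves_near_0 (A B C : R) (X : R -> R) : Prop :=
  X 0 = 0 /\ locally 0 (fun tau => is_derive X tau (Q A B C (X tau))).

(* The local inverse at 0 of any X with [solves_near_0 A B C X], C <> 0. *)
Definition rho (A B C x : R) : R := RInt (fun y => / Q A B C y) 0 x.

(* [F] and [L] are used only at points where X is positive, so that [Rpower]
   is the positive real power. *)
Definition F (A B alpha0 gamma0 nu : R) (X : R -> R) (tau : R) : R :=
  Rpower (X tau) nu *
  exp (RInt (fun r => (alpha0 - nu * A) * X r + gamma0 - nu * B) 0 tau).

Definition L (A B alpha0 gamma0 nu delta : R) (X : R -> R) (tau : R) : R :=
  delta * F A B alpha0 gamma0 nu X tau / X tau.

(* The integral over (0, T] is improper at 0: near 0 the kernel [L] behaves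
   like v^(nu-1), which is unbounded when nu < 1. *)
Definition convolution_converges (l W : R -> R) (T t : R) : Prop :=
  ex_RInt_gen (fun v => l v * W (t + T - v)) (at_right 0) (at_point T).

Definition convolution (l W : R -> R) (T t : R) : R :=
  RInt_gen (fun v => l v * W (t + T - v)) (at_right 0) (at_point T).

(* Main.v *)
Require Import Defs.
From Stdlib Require Import Reals List Factorial Lra Lia FunctionalExtensionality.
From Coquelicot Require Import Coquelicot.
Import ListNotations.
Open Scope R_scope.

(** Write [g_n(x) = sum_k w_{n,k} x^k].  Deleting the last step of a path gives
    [g_{n+1} = Q g_n' + (alpha0 x + gamma0) g_n + delta (g_n - w_{n,0}) / x]
    ([motzkin_row_succ]); summed over [n] this is the first-order equation
    [w_t = Q w_x + (alpha0 x + gamma0) w + delta (w - W) / x].  Along the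
    characteristic [v |-> (X(v), s - v)] it becomes an ordinary linear equation
    whose integrating factor is [F_nu], because
    [F_nu' / F_nu = delta / X + alpha0 X + gamma0] ([F_derive]); so
    [(F_nu(v) w(X(v), s - v))' = L_nu(v) W(s - v)].  As [nu > 0], [F_nu] vanishes
    at [0+], and integrating from [0] to [rho(x)] with [s = t + rho(x)] gives the
    formula, since [X(rho(x)) = x].

    The double series is never differentiated.  The derivative of the partial
    sum [sum_{n<=N} F_nu g_n(X) (s - v)^n / n!] telescopes: it is
    [L_nu] times the partial sum of [W(s - v)], plus the single boundary term
    [F_nu g_{N+1}(X) (s - v)^N / N!] ([approx_derive]).  The bound
    [|w_{n,k}| <= K^n n!] ([motzkin_growth]) makes that term and the tails
    geometrically small, and [is_RInt_limit_of_derivatives] passes to the limit.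

    The limit at [x = 0] then only concerns [w] itself, which is jointly
    continuous up to [x = 0] ([gf_limit_x]).  For the last claim, a second array
    satisfying the formula has the same sum as [w] for small [x > 0] and small
    [t], and such values determine the coefficients, first in [t] and then in
    [x], where only positive [x] are available ([PSeries_right_ext]). *)

(** * Last-step recurrence and growth of the weights *)

(** The starting height is a parameter because [words] grows at the front,
    so that the recursion available by computation moves the start. *)
Definition weight_sum (alpha gamma beta : nat -> R) (h k : nat)
    (l : list (list step)) : R :=
  fold_right Rplus 0
    (map (path_weight alpha gamma beta h) (filter (path_to k h) l)).

Lemma weight_sum_first_step alpha gamma beta h k l :
  weight_sum alpha gamma beta h k
    (flat_map (fun p => [Up :: p; Level :: p; Down :: p]) l) =
  alpha h * weight_sum alpha gamma beta (S h) k l +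
  gamma h * weight_sum alpha gamma beta h k l +
  match h with
  | O => 0
  | S j => beta j * weight_sum alpha gamma beta j k l
  end.
Proof.
  unfold weight_sum; induction l as [|p l IH].
  - destruct h; simpl; ring.
  - simpl flat_map; simpl filter.
    destruct h as [|j].
    + simpl in IH |- *.
      destruct (path_to k 1 p), (path_to k 0 p); simpl; rewrite IH; ring.
    + simpl in IH |- *.
      destruct (path_to k (S (S j)) p), (path_to k (S j) p), (path_to k j p);
        simpl; rewrite IH; ring.
Qed.

Lemma weight_sum_succ alpha gamma beta n h k :
  weight_sum alpha gamma beta h k (words (S n)) =
  alpha h * weight_sum alpha gamma beta (S h) k (words n) +
  gamma h * weight_sum alpha gamma beta h k (words n) +
  match h with
  | O => 0
  | S j => beta j * weight_sum alpha gamma beta j k (words n)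
  end.
Proof. apply weight_sum_first_step. Qed.

(** First-step and last-step decompositions commute, as left and right
    multiplication by the transition matrix do; this turns the first into the
    second by induction on the length. *)
Lemma weight_sum_last_step alpha gamma beta n h k :
  weight_sum alpha gamma beta h k (words (S n)) =
  match k with
  | O => 0
  | S j => alpha j * weight_sum alpha gamma beta h j (words n)
  end +
  gamma k * weight_sum alpha gamma beta h k (words n) +
  beta k * weight_sum alpha gamma beta h (S k) (words n).
Proof.
  revert h k; induction n as [|n IH]; intros h k.
  - rewrite weight_sum_succ.
    assert (E : forall i j, weight_sum alpha gamma beta i j (words 0) =
      if Nat.eq_dec i j then 1 else 0).
    { intros i j; unfold weight_sum; cbn.
      destruct (Nat.eqb_spec i j), (Nat.eq_dec i j); try lia; cbn; ring. }
    destruct h as [|h], k as [|k]; rewrite !E;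
      repeat destruct Nat.eq_dec; try lia; subst;
      repeat match goal with H : S _ = S _ |- _ =>
        injection H; clear H; intros; subst end;
      ring.
  - rewrite weight_sum_succ.
    rewrite (IH h k) at 1; rewrite (IH (S h) k), !weight_sum_succ.
    destruct h as [|h]; [| rewrite (IH h k)];
      (destruct k as [|k]; [| rewrite weight_sum_succ]); ring.
Qed.

Lemma total_weight_succ alpha gamma beta n k :
  total_weight alpha gamma beta (S n) k =
  match k with
  | O => 0
  | S j => alpha j * total_weight alpha gamma beta n j
  end +
  gamma k * total_weight alpha gamma beta n k +
  beta k * total_weight alpha gamma beta n (S k).
Proof. exact (weight_sum_last_step alpha gamma beta n 0 k). Qed.

Lemma total_weight_above alpha gamma beta n k :
  (n < k)%nat -> total_weight alpha gamma beta n k = 0.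
Proof.
  revert k; induction n as [|n IH]; intros k Hk.
  - destruct k; [lia | reflexivity].
  - rewrite total_weight_succ; destruct k as [|k]; [lia |].
    rewrite !IH by lia; ring.
Qed.

(** Uniform in [k]: this suffices since [x] is kept at most [1/2], where the
    sum over [k] is dominated by a geometric series. *)
Definition growth (K : R) (u : nat -> nat -> R) : Prop :=
  forall n k, Rabs (u n k) <= K ^ n * INR (fact n).

Lemma affine_bound a b M k :
  Rabs a + Rabs b <= M -> Rabs (affine a b k) <= M * INR (S k).
Proof.
  intros H; unfold affine; rewrite S_INR.
  pose proof (pos_INR k); pose proof (Rabs_pos a); pose proof (Rabs_pos b).
  eapply Rle_trans; [apply Rabs_triang |].
  rewrite Rabs_mult, (Rabs_pos_eq (INR k)) by assumption; nra.
Qed.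

Lemma Rabs_mult_le x y a b :
  Rabs x <= a -> Rabs y <= b -> Rabs (x * y) <= a * b.
Proof.
  intros; rewrite Rabs_mult; apply Rmult_le_compat; auto using Rabs_pos.
Qed.

(** A path of length [n] stays at heights at most [n], so its next step has
    weight at most [M (n + 1)], and there are three kinds of step. *)
Lemma motzkin_growth A B C alpha0 beta0 gamma0 M :
  Rabs A + Rabs alpha0 <= M -> Rabs B + Rabs gamma0 <= M ->
  Rabs C + Rabs beta0 <= M ->
  growth (3 * M) (motzkin_weight A B C alpha0 beta0 gamma0).
Proof.
  intros HA HB HC n.
  assert (HM : 0 <= M)
    by (pose proof (Rabs_pos A); pose proof (Rabs_pos alpha0); lra).
  induction n as [|n IH]; intros k.
  - unfold motzkin_weight, total_weight; destruct k; simpl;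
      rewrite ?Rplus_0_r, ?Rabs_R1, ?Rabs_R0; lra.
  - unfold motzkin_weight in *; rewrite total_weight_succ.
    set (w := total_weight (affine A alpha0) (affine B gamma0)
                (affine C beta0)) in *.
    assert (P : 0 <= (3 * M) ^ n * INR (fact n))
      by (apply Rmult_le_pos; [apply pow_le; lra | apply pos_INR]).
    assert (E : forall (a b : R) i j, Rabs a + Rabs b <= M -> (i <= j)%nat ->
      Rabs (affine a b i * w n j) <=
        M * INR (S n) * ((3 * M) ^ n * INR (fact n))).
    { intros a b i j Hab Hij.
      destruct (Nat.lt_ge_cases n j) as [Hj|Hj].
      - unfold w; rewrite (total_weight_above _ _ _ _ _ Hj), Rmult_0_r, Rabs_R0.
        apply Rmult_le_pos; [apply Rmult_le_pos; [lra | apply pos_INR] | lra].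
      - apply Rabs_mult_le; [| apply IH].
        eapply Rle_trans; [apply affine_bound; eassumption |].
        apply Rmult_le_compat_l; [lra |]. apply le_INR; lia. }
    assert (E0 := E A alpha0 (pred k) (pred k) HA (le_n _)).
    assert (E1 := E B gamma0 k k HB (le_n _)).
    assert (E2 := E C beta0 k (S k) HC (le_S _ _ (le_n _))).
    assert (T : (3 * M) ^ S n * INR (fact (S n)) =
      3 * (M * INR (S n) * ((3 * M) ^ n * INR (fact n))))
      by (rewrite fact_simpl, mult_INR; simpl pow; ring).
    rewrite T.
    eapply Rle_trans; [apply Rabs_triang |].
    eapply Rle_trans; [apply Rplus_le_compat_r, Rabs_triang |].
    enough (Rabs (match k with
                  | O => 0
                  | S j => affine A alpha0 j * w n j
                  end) <= M * INR (S n) * ((3 * M) ^ n * INR (fact n))) by lra.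
    destruct k as [|k]; [| exact E0].
    rewrite Rabs_R0; eapply Rle_trans; [apply Rabs_pos | exact E0].
Qed.

(** * Geometric estimates for the generating function *)

Lemma geometric_bound (a : nat -> R) (M q : R) :
  0 <= q <= 1 / 2 -> (forall n, Rabs (a n) <= M * q ^ n) ->
  ex_series (fun n => Rabs (a n)) /\ Series (fun n => Rabs (a n)) <= 2 * M.
Proof.
  intros Hq Ha.
  assert (HM : 0 <= M)
    by (specialize (Ha 0%nat); pose proof (Rabs_pos (a 0%nat)); simpl in Ha; lra).
  assert (Hg : is_series (fun n => q ^ n) (/ (1 - q)))
    by (apply is_series_geom; rewrite Rabs_pos_eq; lra).
  assert (Hs : ex_series (fun n => M * q ^ n))
    by (apply (ex_series_scal (V := R_NormedModule) M (fun n => q ^ n));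
      eexists; exact Hg).
  split.
  - apply (ex_series_le (V := R_CompleteNormedModule)
      (fun n => Rabs (a n)) (fun n => M * q ^ n)); [| exact Hs].
    intros n; unfold norm; simpl; unfold abs; simpl; rewrite Rabs_Rabsolu; auto.
  - eapply Rle_trans;
      [apply (Series_le _ (fun n => M * q ^ n)); auto using Rabs_pos |].
    rewrite (Series_scal_l M (fun n => q ^ n)), (is_series_unique _ _ Hg).
    assert (/ (1 - q) <= 2).
    { replace 2 with (/ (1 / 2)) by field; apply Rinv_le_contravar; lra. }
    nra.
Qed.

Lemma term_growth (a : nat -> R) (M K x : R) n :
  (forall n, Rabs (a n) <= M * K ^ n) ->
  Rabs (a n * x ^ n) <= M * (K * Rabs x) ^ n.
Proof.
  intros Ha; rewrite Rabs_mult, <- RPow_abs, Rpow_mult_distr, <- Rmult_assoc.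
  apply Rmult_le_compat_r; [apply pow_le, Rabs_pos | apply Ha].
Qed.

Lemma PSeries_bound (a : nat -> R) (M K x : R) :
  (forall n, Rabs (a n) <= M * K ^ n) -> 0 <= K -> K * Rabs x <= 1 / 2 ->
  Rabs (PSeries a x) <= 2 * M.
Proof.
  intros Ha HK Hx; pose proof (Rabs_pos x).
  destruct (geometric_bound (fun n => a n * x ^ n) M (K * Rabs x)) as [H1 H2].
  - split; [nra | assumption].
  - intros n; apply term_growth; assumption.
  - eapply Rle_trans; [apply Series_Rabs; exact H1 | exact H2].
Qed.

Lemma PSeries_tail (a : nat -> R) (M K x : R) N :
  (forall n, Rabs (a n) <= M * K ^ n) -> 0 <= K -> K * Rabs x <= 1 / 2 ->
  Rabs (PSeries a x - sum_f_R0 (fun n => a n * x ^ n) N) <=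
    2 * M * (1 / 2) ^ S N.
Proof.
  intros Ha HK Hx; pose proof (Rabs_pos x).
  assert (HM : 0 <= M)
    by (specialize (Ha 0%nat); pose proof (Rabs_pos (a 0%nat)); simpl in Ha; lra).
  assert (Hq : 0 <= K * Rabs x <= 1 / 2) by (split; [nra | assumption]).
  destruct (geometric_bound (fun n => a n * x ^ n) M (K * Rabs x)) as [H1 _];
    [assumption | intros n; apply term_growth; assumption |].
  unfold PSeries; rewrite (Series_incr_n _ (S N));
    [| lia | apply ex_series_Rabs; exact H1].
  simpl Init.Nat.pred; rewrite Rplus_minus_l.
  destruct (geometric_bound (fun n => a (S N + n)%nat * x ^ (S N + n))
    (M * (1 / 2) ^ S N) (K * Rabs x)) as [H2 H3]; [assumption | |].
  - intros n; eapply Rle_trans; [apply term_growth; exact Ha |].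
    rewrite pow_add, Rmult_assoc; apply Rmult_le_compat_l; [assumption |].
    apply Rmult_le_compat_r; [apply pow_le; lra | apply pow_incr; lra].
  - eapply Rle_trans; [apply Series_Rabs; exact H2 |].
    eapply Rle_trans; [exact H3 | lra].
Qed.

Lemma growth_CV_radius (a : nat -> R) (M K x : R) :
  (forall n, Rabs (a n) <= M * K ^ n) -> 0 < K -> K * Rabs x < 1 ->
  Rbar_lt (Rabs x) (CV_radius a).
Proof.
  intros Ha HK Hx.
  apply Rbar_lt_le_trans with (Finite (/ K)).
  - simpl; apply (Rmult_lt_reg_l K); [assumption |].
    rewrite Rinv_r; lra.
  - apply (proj1 (CV_radius_bounded a)); exists M; intros n.
    eapply Rle_trans; [apply term_growth; exact Ha |].
    rewrite Rabs_pos_eq, Rinv_r, pow1 by (try apply Rlt_le, Rinv_0_lt_compat; lra).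
    lra.
Qed.

Lemma gf_PSeries u x t :
  gf u x t = PSeries (fun n => PSeries (u n) x / INR (fact n)) t.
Proof.
  unfold gf, PSeries; apply Series_ext; intros n.
  unfold Rdiv; rewrite <- !Series_scal_r; apply Series_ext; intros k.
  unfold term; field; apply INR_fact_neq_0.
Qed.

Lemma Rabs_div_fact_le y c n :
  Rabs y <= c * INR (fact n) -> Rabs (y / INR (fact n)) <= c.
Proof.
  intros Hy; pose proof (INR_fact_lt_0 n).
  unfold Rdiv; rewrite Rabs_mult, (Rabs_pos_eq (/ _))
    by (apply Rlt_le, Rinv_0_lt_compat; assumption).
  apply (Rmult_le_reg_r (INR (fact n))); [assumption |].
  rewrite Rmult_assoc, Rinv_l, Rmult_1_r by lra; exact Hy.
Qed.

Lemma row_CV_radius_growth K u n x :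
  growth K u -> Rabs x <= 1 / 2 -> Rbar_lt (Rabs x) (CV_radius (u n)).
Proof.
  intros Hu Hx; apply (growth_CV_radius _ (K ^ n * INR (fact n)) 1); try lra.
  intros k; rewrite pow1, Rmult_1_r; apply Hu.
Qed.

Lemma row_PSeries_bound K u n x :
  growth K u -> Rabs x <= 1 / 2 ->
  Rabs (PSeries (u n) x) <= 2 * (K ^ n * INR (fact n)).
Proof.
  intros Hu Hx; apply (PSeries_bound _ _ 1); try lra.
  intros k; rewrite pow1, Rmult_1_r; apply Hu.
Qed.

Lemma column_growth K u n x :
  growth K u -> Rabs x <= 1 / 2 ->
  Rabs (PSeries (u n) x / INR (fact n)) <= 2 * K ^ n.
Proof.
  intros Hu Hx; apply Rabs_div_fact_le; rewrite Rmult_assoc.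
  apply row_PSeries_bound; assumption.
Qed.

Lemma growth_abs_summable K u x t :
  growth K u -> 0 <= K -> Rabs x <= 1 / 2 -> K * Rabs t <= 1 / 2 ->
  abs_summable u x t.
Proof.
  intros Hu HK Hx Ht; pose proof (Rabs_pos x); pose proof (Rabs_pos t).
  assert (E : forall n k, Rabs (term u x t n k) <=
    (K * Rabs t) ^ n * Rabs x ^ k).
  { intros n k; pose proof (INR_fact_lt_0 n).
    replace (term u x t n k) with (u n k / INR (fact n) * (t ^ n * x ^ k))
      by (unfold term; field; lra).
    rewrite Rpow_mult_distr, Rmult_assoc, !(RPow_abs), <- Rabs_mult.
    apply Rabs_mult_le; [apply Rabs_div_fact_le, Hu | apply Rle_refl]. }
  assert (E' : forall n, ex_series (fun k => Rabs (term u x t n k)) /\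
    Series (fun k => Rabs (term u x t n k)) <= 2 * (K * Rabs t) ^ n)
    by (intros n; apply (geometric_bound _ _ (Rabs x)); [lra | apply E]).
  split; [intros n; apply E' |].
  destruct (geometric_bound
    (fun n => Series (fun k => Rabs (term u x t n k))) 2 (K * Rabs t))
    as [H1 _]; [split; [nra | assumption] | | apply ex_series_Rabs; exact H1].
  intros n; rewrite Rabs_pos_eq; [apply E' |].
  destruct (E' n) as [H1 _].
  exact (Rle_trans _ _ _ (Rabs_pos _) (Series_Rabs _ H1)).
Qed.

(** * Coefficients are determined by the values at positive x *)

Lemma locally_Rabs (x r : R) (P : R -> Prop) :
  0 < r -> (forall y, Rabs (y - x) < r -> P y) -> locally x P.
Proof. intros Hr H; exists (mkposreal r Hr); exact H. Qed.

Lemma at_right_intro (x r : R) (P : R -> Prop) :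
  0 < r -> (forall y, x < y < x + r -> P y) -> at_right x P.
Proof.
  intros Hr H; apply (locally_Rabs x r); [assumption |].
  intros y Hy Hxy; apply H; apply Rabs_def2 in Hy; lra.
Qed.

Lemma PSeries_right_0 (c : nat -> R) :
  Rbar_lt 0 (CV_radius c) ->
  filterlim (PSeries c) (at_right 0) (locally (c 0%nat)).
Proof.
  intros Hc; rewrite <- PSeries_0.
  apply (filterlim_filter_le_1 (F := locally 0) (G := at_right 0));
    [apply filter_le_within |].
  apply continuity_pt_filterlim, PSeries_continuity.
  rewrite Rabs_R0; assumption.
Qed.

(** The identity theorem for power series agreeing on one side of [0] only:
    let [x] tend to [0+] to get the constant terms, divide by [x], and repeat. *)
Lemma PSeries_right_ext (a b : nat -> R) (r : R) n :
  0 < r -> Rbar_le r (CV_radius a) -> Rbar_le r (CV_radius b) ->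
  (forall x, 0 < x < r -> PSeries a x = PSeries b x) ->
  a n = b n.
Proof.
  intros Hr; revert a b; induction n as [|n IH]; intros a b Ha Hb E;
  (assert (E0 : a 0%nat = b 0%nat);
   [ apply (filterlim_locally_unique (F := at_right 0) (PSeries a));
     [| apply (filterlim_ext_loc (PSeries b))];
     [ apply PSeries_right_0; apply Rbar_lt_le_trans with r; assumption
     | apply (at_right_intro 0 r); [assumption |];
       intros y Hy; symmetry; apply E; lra
     | apply PSeries_right_0; apply Rbar_lt_le_trans with r; assumption ]
   |]); [exact E0 |].
  apply (IH (PS_decr_1 a) (PS_decr_1 b)); rewrite ?CV_radius_decr_1; auto.
  intros x Hx.
  assert (Hin : forall c, Rbar_le r (CV_radius c) -> ex_pseries c x).
  { intros c Hc; apply CV_radius_inside.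
    apply Rbar_lt_le_trans with r; [| assumption].
    rewrite Rabs_pos_eq; simpl; lra. }
  specialize (E x Hx).
  rewrite (PSeries_decr_1 a), (PSeries_decr_1 b), E0 in E by auto.
  apply (Rmult_eq_reg_l x); [| apply Rgt_not_eq]; lra.
Qed.

Lemma le_CV_radius (a : nat -> R) (x : R) :
  0 <= x -> ex_series (fun n => Rabs (a n * x ^ n)) ->
  Rbar_le x (CV_radius a).
Proof.
  intros Hx H; apply Rbar_not_lt_le; intros Hlt.
  apply (CV_disk_outside a x).
  - rewrite Rabs_pos_eq; assumption.
  - apply ex_series_lim_0, ex_series_Rabs, H.
Qed.

Lemma gf_coeff_CV_radius u x t :
  0 < t -> abs_summable u x t ->
  Rbar_le t (CV_radius (fun n => PSeries (u n) x / INR (fact n))).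
Proof.
  intros Ht [H1 H2]; apply le_CV_radius; [lra |].
  apply (ex_series_le (V := R_CompleteNormedModule) _
    (fun n => Series (fun k => Rabs (term u x t n k)))); [| exact H2].
  intros n; unfold norm; simpl; unfold abs; simpl; rewrite Rabs_Rabsolu.
  eapply Rle_trans; [| apply Series_Rabs, H1].
  apply Req_le; f_equal; unfold PSeries, Rdiv.
  rewrite <- !Series_scal_r; apply Series_ext; intros k; unfold term.
  field; apply INR_fact_neq_0.
Qed.

Lemma row_CV_radius u x t n :
  0 < x -> 0 < t -> abs_summable u x t -> Rbar_le x (CV_radius (u n)).
Proof.
  intros Hx Ht [H1 _]; apply le_CV_radius; [lra |].
  pose proof (INR_fact_lt_0 n).
  assert (Ht' : 0 < t ^ n) by (apply pow_lt; assumption).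
  apply (ex_series_ext (V := R_NormedModule)
    (fun k => INR (fact n) / t ^ n * Rabs (term u x t n k))).
  - intros k; unfold term.
    replace (u n k * x ^ k * t ^ n / INR (fact n))
      with (u n k * x ^ k * (t ^ n / INR (fact n))) by (field; lra).
    rewrite (Rabs_mult (u n k * x ^ k)), (Rabs_pos_eq (t ^ n / _))
      by (apply Rlt_le, Rdiv_lt_0_compat; assumption).
    simpl; field; lra.
  - apply (ex_series_scal (V := R_NormedModule) (INR (fact n) / t ^ n)
      (fun k => Rabs (term u x t n k))), H1.
Qed.

(** The equality in [t] holds on both sides of [0] and gives [g_n] for each
    [x > 0]; the equality in [x] holds on the right only. *)
Lemma gf_determines_coefficients u v (r : R) :
  0 < r ->
  (forall x t, Rabs x < r -> Rabs t < r -> abs_summable u x t) ->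
  (forall x t, Rabs x < r -> Rabs t < r -> abs_summable v x t) ->
  (forall x t, 0 < x < r -> Rabs t < r -> gf u x t = gf v x t) ->
  forall n k, u n k = v n k.
Proof.
  intros Hr Hu Hv E n k.
  apply (PSeries_right_ext _ _ (r / 2)); try lra.
  1,2: apply (row_CV_radius _ _ (r / 2)); try lra;
    (apply Hu || apply Hv); rewrite Rabs_pos_eq; lra.
  intros x Hx.
  assert (Hx' : Rabs x < r) by (rewrite Rabs_pos_eq; lra).
  pose proof (INR_fact_lt_0 n).
  apply (Rmult_eq_reg_r (/ INR (fact n)));
    [| apply Rinv_neq_0_compat; lra].
  apply (PSeries_ext_recip (fun n => PSeries (u n) x / INR (fact n))
    (fun n => PSeries (v n) x / INR (fact n)) n).
  1,2: apply Rbar_lt_le_trans with (r / 2); [simpl; lra |];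
    apply gf_coeff_CV_radius; [lra |];
    (apply Hu || apply Hv); auto; rewrite Rabs_pos_eq; lra.
  apply (locally_Rabs 0 r); [assumption |]; intros t Ht.
  rewrite <- !gf_PSeries; apply E; [lra |].
  now rewrite Rminus_0_r in Ht.
Qed.

(** * The recurrence for the rows *)

(** In coefficients, multiplication by [x] and [d/dx] shift and weight the row.
    The down-weight [C k + beta0] splits as [C (k + 1) + delta]: the first part
    comes from [C g_n'], the second from [delta (g_n - w_{n,0}) / x]. *)
Lemma motzkin_row_succ A B C alpha0 beta0 gamma0 n x :
  let w := motzkin_weight A B C alpha0 beta0 gamma0 in
  x <> 0 -> Rbar_lt (Rabs x) (CV_radius (w n)) ->
  PSeries (w (S n)) x =
  Q A B C x * PSeries (PS_derive (w n)) x +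
  (alpha0 * x + gamma0) * PSeries (w n) x +
  (beta0 - C) * (PSeries (w n) x - w n 0%nat) / x.
Proof.
  intros w Hx Hcv.
  set (g := PSeries (w n) x); set (g' := PSeries (PS_derive (w n)) x).
  assert (Hg : is_pseries (w n) x g)
    by (apply PSeries_correct, CV_radius_inside; assumption).
  assert (Hg' : is_pseries (PS_derive (w n)) x g')
    by (apply PSeries_correct, ex_pseries_derive; assumption).
  assert (Hg'1 := is_pseries_incr_1 _ _ _ Hg').
  assert (Hg'2 := is_pseries_incr_1 _ _ _ Hg'1).
  assert (Hg1 := is_pseries_incr_1 _ _ _ Hg).
  assert (Hgd := is_pseries_decr_1 _ x (/ x) _ (Rinv_l x Hx) Hg).
  assert (comm : forall y : R, mult x y = mult y x) by (intros y; apply Rmult_comm).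
  assert (H := is_pseries_plus _ _ _ _ _
    (is_pseries_plus _ _ _ _ _
      (is_pseries_plus _ _ _ _ _
        (is_pseries_scal A _ _ _ (comm A) Hg'2)
        (is_pseries_scal B _ _ _ (comm B) Hg'1))
      (is_pseries_scal C _ _ _ (comm C) Hg'))
    (is_pseries_plus _ _ _ _ _
      (is_pseries_plus _ _ _ _ _
        (is_pseries_scal alpha0 _ _ _ (comm alpha0) Hg1)
        (is_pseries_scal gamma0 _ _ _ (comm gamma0) Hg))
      (is_pseries_scal (beta0 - C) _ _ _ (comm (beta0 - C)) Hgd))).
  apply is_pseries_unique in H.
  transitivity (PSeries (PS_plus
    (PS_plus (PS_plus (PS_scal A (PS_incr_1 (PS_incr_1 (PS_derive (w n)))))
       (PS_scal B (PS_incr_1 (PS_derive (w n)))))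
       (PS_scal C (PS_derive (w n))))
    (PS_plus (PS_plus (PS_scal alpha0 (PS_incr_1 (w n)))
       (PS_scal gamma0 (w n))) (PS_scal (beta0 - C) (PS_decr_1 (w n))))) x).
  - apply PSeries_ext; intros k; unfold w at 1, motzkin_weight.
    rewrite total_weight_succ.
    change (total_weight (affine A alpha0) (affine B gamma0) (affine C beta0) n)
      with (w n).
    unfold PS_plus, PS_scal, PS_decr_1, PS_incr_1, PS_derive, affine,
      plus, scal, zero; cbn -[INR]; unfold mult; cbn -[INR].
    destruct k as [|[|k]]; cbn -[INR]; rewrite ?S_INR;
      change (INR 0) with 0; ring.
  - rewrite H; unfold plus, opp, scal, Q; simpl; unfold mult; simpl.
    field; assumption.
Qed.

(** * Bounds and continuity of the generating function *)

Lemma gf_bound K u x t :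
  growth K u -> 0 <= K -> Rabs x <= 1 / 2 -> K * Rabs t <= 1 / 2 ->
  Rabs (gf u x t) <= 4.
Proof.
  intros Hu HK Hx Ht; rewrite gf_PSeries; replace 4 with (2 * 2) by ring.
  apply (PSeries_bound _ _ K); try assumption.
  intros n; apply column_growth; assumption.
Qed.

Lemma gf_continuous_t K u x t :
  growth K u -> 0 < K -> Rabs x <= 1 / 2 -> K * Rabs t < 1 ->
  continuous (gf u x) t.
Proof.
  intros Hu HK Hx Ht.
  apply (continuous_ext (PSeries (fun n => PSeries (u n) x / INR (fact n))));
    [intros s; symmetry; apply gf_PSeries |].
  apply continuity_pt_filterlim, PSeries_continuity.
  apply (growth_CV_radius _ 2 K); try assumption.
  intros n; apply column_growth; assumption.
Qed.

(** Each [g_n(x) - g_n(0)] is [x] times a power series obeying the same bound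
    as [g_n]. *)
Lemma gf_lipschitz_x K u x t :
  growth K u -> 0 < K -> Rabs x <= 1 / 2 -> K * Rabs t <= 1 / 2 ->
  Rabs (gf u x t - gf u 0 t) <= 4 * Rabs x.
Proof.
  intros Hu HK Hx Ht.
  assert (Hrow : forall n, ex_pseries (u n) x).
  { intros n; apply CV_radius_inside, (row_CV_radius_growth K); assumption. }
  assert (Hex : forall y, Rabs y <= 1 / 2 ->
    ex_pseries (fun n => PSeries (u n) y / INR (fact n)) t).
  { intros y Hy; apply CV_radius_inside.
    apply (growth_CV_radius _ 2 K); try lra.
    intros n; apply column_growth; assumption. }
  rewrite !gf_PSeries, <- PSeries_minus by
    (apply Hex; rewrite ?Rabs_R0; lra).
  replace (4 * Rabs x) with (2 * (2 * Rabs x)) by ring.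
  apply (PSeries_bound _ _ K); try lra.
  intros n; unfold PS_minus, PS_plus, PS_opp, plus, opp; simpl.
  rewrite PSeries_0, PSeries_decr_1 by apply Hrow.
  pose proof (INR_fact_lt_0 n).
  replace ((u n 0%nat + x * PSeries (PS_decr_1 (u n)) x) / INR (fact n) +
    - (u n 0%nat / INR (fact n)))
    with (x * (PSeries (PS_decr_1 (u n)) x / INR (fact n))) by (field; lra).
  replace (2 * Rabs x * K ^ n) with (Rabs x * (2 * K ^ n)) by ring.
  apply Rabs_mult_le; [apply Rle_refl |].
  apply Rabs_div_fact_le; rewrite Rmult_assoc.
  apply (PSeries_bound _ _ 1); try lra.
  intros k; rewrite pow1, Rmult_1_r; apply Hu.
Qed.

Lemma gf_limit_x K u t :
  growth K u -> 0 < K -> K * Rabs t < 1 / 2 ->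
  filterlim (fun p : R * R => gf u (fst p) (snd p))
    (filter_prod (at_right 0) (locally t)) (locally (gf u 0 t)).
Proof.
  intros Hu HK Ht.
  assert (Hc : continuous (gf u 0) t)
    by (apply (gf_continuous_t K); try assumption; rewrite ?Rabs_R0; lra).
  apply filterlim_locally; intros eps.
  assert (He := cond_pos eps).
  apply (Filter_prod _ _ _ (fun x => 0 < x /\ x <= 1 / 2 /\ 4 * x < eps / 2)
    (fun s => K * Rabs s <= 1 / 2 /\ Rabs (gf u 0 s - gf u 0 t) < eps / 2)).
  - apply (at_right_intro 0 (Rmin (1 / 2) (eps / 8)));
      [apply Rmin_pos; lra |].
    intros y Hy; pose proof (Rmin_l (1 / 2) (eps / 8));
      pose proof (Rmin_r (1 / 2) (eps / 8)); lra.
  - apply filter_and.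
    + apply (locally_Rabs t (1 / 2 / K - Rabs t)).
      * apply Rlt_0_minus, (Rmult_lt_reg_l K); [assumption |].
        replace (K * (1 / 2 / K)) with (1 / 2) by (field; lra); assumption.
      * intros s Hs.
        assert (H : Rabs s <= 1 / 2 / K).
        { replace s with ((s - t) + t) by ring.
          eapply Rle_trans; [apply Rabs_triang | lra]. }
        replace (1 / 2) with (K * (1 / 2 / K)) by (field; lra).
        apply Rmult_le_compat_l; lra.
    + assert (He2 : 0 < eps / 2) by lra.
      exact (proj1 (filterlim_locally _ _) Hc (mkposreal _ He2)).
  - intros x s [Hx0 [Hx1 Hx2]] [Hs1 Hs2]; simpl.
    assert (H : Rabs (gf u x s - gf u 0 s) <= 4 * Rabs x)
      by (apply (gf_lipschitz_x K); try assumption; rewrite Rabs_pos_eq; lra).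
    rewrite (Rabs_pos_eq x) in H by lra.
    change (Rabs (gf u x s - gf u 0 t) < eps).
    replace (gf u x s - gf u 0 t)
      with ((gf u x s - gf u 0 s) + (gf u 0 s - gf u 0 t)) by ring.
    eapply Rle_lt_trans; [apply Rabs_triang | lra].
Qed.

(** * Integrals as limits of increments *)

Lemma is_derive_RInt_right (g : R -> R) (lo hi a y : R) :
  lo < a < hi -> lo < y < hi -> (forall z, lo < z < hi -> continuous g z) ->
  is_derive (RInt g a) y (g y).
Proof.
  intros Ha Hy Hg; apply (is_derive_RInt _ _ a); [| apply Hg; assumption].
  apply (locally_Rabs y (Rmin (y - lo) (hi - y))); [apply Rmin_pos; lra |].
  intros z Hz; apply Rabs_def2 in Hz.
  pose proof (Rmin_l (y - lo) (hi - y)); pose proof (Rmin_r (y - lo) (hi - y)).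
  apply (RInt_correct (V := R_CompleteNormedModule)).
  apply (ex_RInt_continuous (V := R_CompleteNormedModule)); intros u Hu; apply Hg.
  split; [eapply Rlt_le_trans; [| apply Hu] | eapply Rle_lt_trans; [apply Hu |]].
  - apply Rmin_glb_lt; lra.
  - apply Rmax_lub_lt; lra.
Qed.

Lemma is_derive_continuity_pt (f : R -> R) x l :
  is_derive f x l -> continuity_pt f x.
Proof.
  intros H; apply continuity_pt_filterlim.
  apply (ex_derive_continuous (V := R_NormedModule)); eexists; exact H.
Qed.

Lemma mean_value (f df : R -> R) (a b : R) :
  a <= b -> (forall x, a <= x <= b -> is_derive f x (df x)) ->
  exists c, a <= c <= b /\ f b - f a = df c * (b - a).
Proof.
  intros Hab H.
  destruct (MVT_gen f a b df) as [c Hc].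
  - rewrite Rmin_left, Rmax_right by assumption; intros; apply H; lra.
  - rewrite Rmin_left, Rmax_right by assumption; intros x Hx.
    eapply is_derive_continuity_pt, H; exact Hx.
  - rewrite Rmin_left, Rmax_right in Hc by assumption; exists c; exact Hc.
Qed.

(** The mean value theorem bounds [f_N(b) - f_N(a) - RInt g a b] by
    [e_N (b - a)], which avoids integrating [df_N].  The margin [lo < a], [b < hi] makes the integral of [g]
    differentiable at the endpoints. *)
Lemma is_RInt_limit_of_derivatives (lo hi a b : R) (f df : nat -> R -> R)
    (flim g : R -> R) (e : nat -> R) :
  lo < a -> a <= b -> b < hi ->
  (forall N x, lo < x < hi -> is_derive (f N) x (df N x)) ->
  (forall N x, a <= x <= b -> Rabs (df N x - g x) <= e N) ->
  (forall x, a <= x <= b -> is_lim_seq (fun N => f N x) (flim x)) ->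
  is_lim_seq e 0 -> (forall x, lo < x < hi -> continuous g x) ->
  is_RInt g a b (flim b - flim a).
Proof.
  intros Hlo Hab Hhi Hdf He Hlim He0 Hg.
  assert (HI : ex_RInt g a b).
  { apply (ex_RInt_continuous (V := R_CompleteNormedModule)).
    rewrite Rmin_left, Rmax_right by assumption; intros; apply Hg; lra. }
  replace (flim b - flim a) with (RInt g a b);
    [apply (RInt_correct (V := R_CompleteNormedModule)); exact HI |].
  assert (Hfin : forall l l' : R, is_lim_seq (fun N => f N b - f N a) l ->
    is_lim_seq (fun N => f N b - f N a) l' -> l = l').
  { intros l l' H H'; apply is_lim_seq_unique in H, H'.
    rewrite H in H'; now injection H'. }
  apply Hfin; [| apply is_lim_seq_minus'; apply Hlim; lra].
  assert (Hz : is_lim_seq (fun N => f N b - f N a - RInt g a b) 0).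
  { apply is_lim_seq_abs_0.
    apply (is_lim_seq_le_le (fun _ => 0) _ (fun N => e N * (b - a)));
      [| apply is_lim_seq_const
       | replace (Finite 0) with (Rbar_mult 0 (b - a))
           by (simpl; f_equal; ring);
         apply is_lim_seq_scal_r; exact He0].
    intros N; split; [apply Rabs_pos |].
    destruct (mean_value (fun x => f N x - RInt g a x)
      (fun x => df N x - g x) a b Hab) as [c [Hc E]].
    - intros x Hx; apply (is_derive_minus (V := R_NormedModule)).
      + apply Hdf; lra.
      + apply (is_derive_RInt_right _ lo hi); try lra; exact Hg.
    - rewrite RInt_point in E; unfold zero in E; simpl in E.
      replace (f N b - f N a - RInt g a b)
        with ((df N c - g c) * (b - a)) by lra.
      apply Rabs_mult_le; [apply He; exact Hc | rewrite Rabs_pos_eq; lra]. }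
  replace (Finite (RInt g a b)) with (Finite (0 + RInt g a b)) by (f_equal; ring).
  apply (is_lim_seq_ext
    (fun N => (f N b - f N a - RInt g a b) + RInt g a b)); [intros; ring |].
  apply is_lim_seq_plus'; [exact Hz | apply is_lim_seq_const].
Qed.

(** * The inverse functions X and rho *)

Lemma Q_continuous A B C x : continuous (Q A B C) x.
Proof.
  apply (ex_derive_continuous (V := R_NormedModule)); unfold Q; auto_derive; auto.
Qed.

Lemma Q_pos_near_0 A B C :
  0 < C -> exists r, 0 < r /\ forall y, Rabs y < r -> 0 < Q A B C y.
Proof.
  intros HC.
  destruct (proj1 (filterlim_locally _ _) (Q_continuous A B C 0) (mkposreal C HC))
    as [r Hr].
  exists r; split; [apply cond_pos |]; intros y Hy.
  assert (H : Rabs (Q A B C y - Q A B C 0) < C).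
  { apply Hr; change (Rabs (y - 0) < r); now rewrite Rminus_0_r. }
  unfold Q in H |- *; apply Rabs_def2 in H; lra.
Qed.

(** With [Q > 0] near [0], [rho] is increasing there and [rho (X tau)] has
    derivative [1]; hence [rho] inverts [X], and injectivity of [rho] gives the
    other composition. *)
Section LocalInverse.
Context (A B C r : R).
Context (HQ : forall y, Rabs y < r -> 0 < Q A B C y).

Lemma rho_derive x : Rabs x < r -> is_derive (rho A B C) x (/ Q A B C x).
Proof.
  intros Hx; pose proof (Rabs_pos x); apply Rabs_def2 in Hx.
  apply (is_derive_RInt_right (fun y => / Q A B C y) (- r) r); try lra.
  intros z Hz; assert (Hz' : 0 < Q A B C z) by (apply HQ, Rabs_def1; lra).
  apply (ex_derive_continuous (V := R_NormedModule)); unfold Q in *.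
  auto_derive; simpl in Hz'; lra.
Qed.

Lemma rho_0 : rho A B C 0 = 0.
Proof. unfold rho; now rewrite RInt_point. Qed.

Lemma rho_increasing x y :
  Rabs x < r -> Rabs y < r -> x < y -> rho A B C x < rho A B C y.
Proof.
  intros Hx Hy Hxy; apply Rabs_def2 in Hx, Hy.
  destruct (mean_value (rho A B C) (fun x => / Q A B C x) x y) as [c [Hc E]];
    [lra | intros z Hz; apply rho_derive, Rabs_def1; lra |].
  assert (0 < / Q A B C c) by (apply Rinv_0_lt_compat, HQ, Rabs_def1; lra).
  nra.
Qed.

Context (X : R -> R) (d : R).
Context (X0 : X 0 = 0)
  (HX : forall tau, Rabs tau < d ->
     is_derive X tau (Q A B C (X tau)) /\ Rabs (X tau) < r).

Lemma rho_X tau : Rabs tau < d -> rho A B C (X tau) = tau.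
Proof.
  intros Ht; apply Rabs_def2 in Ht.
  assert (D : forall z, - d < z < d ->
    is_derive (fun z => rho A B C (X z)) z 1).
  { intros z Hz; destruct (HX z) as [H1 H2]; [apply Rabs_def1; lra |].
    replace 1 with (scal (Q A B C (X z)) (/ Q A B C (X z))).
    - apply (is_derive_comp (V := R_NormedModule) (rho A B C) X);
        [apply rho_derive |]; assumption.
    - unfold scal; simpl; unfold mult; simpl; apply Rinv_r.
      apply Rgt_not_eq, HQ, H2. }
  destruct (Rle_or_lt 0 tau) as [H|H];
    [destruct (mean_value (fun z => rho A B C (X z)) (fun _ => 1) 0 tau)
       as [c [_ E]]
    |destruct (mean_value (fun z => rho A B C (X z)) (fun _ => 1) tau 0)
       as [c [_ E]]];
    try lra; try (intros; apply D; lra);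
    rewrite X0, rho_0 in E; lra.
Qed.

Lemma X_pos tau : 0 < tau < d -> 0 < X tau.
Proof.
  intros Ht; assert (Ha : Rabs tau < d) by (rewrite Rabs_pos_eq; lra).
  assert (H0 : Rabs 0 < r)
    by (rewrite Rabs_R0; eapply Rle_lt_trans; [apply Rabs_pos | apply (HX tau Ha)]).
  destruct (Rtotal_order (X tau) 0) as [H|[H|H]]; [| | exact H]; exfalso.
  - apply rho_increasing in H; [| apply HX; exact Ha | exact H0].
    rewrite rho_X, rho_0 in H by exact Ha; lra.
  - pose proof (rho_X tau Ha) as E; rewrite H, rho_0 in E; lra.
Qed.

Lemma X_rho eta :
  0 < r -> 0 < eta <= d ->
  exists r', 0 < r' /\ forall x, 0 < x < r' ->
    0 < rho A B C x < eta /\ X (rho A B C x) = x.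
Proof.
  intros Hr Heta.
  assert (Hc : continuous (rho A B C) 0).
  { apply (ex_derive_continuous (V := R_NormedModule)); eexists.
    apply rho_derive; rewrite Rabs_R0; exact Hr. }
  destruct (proj1 (filterlim_locally _ _) Hc (mkposreal eta (proj1 Heta)))
    as [r' Hr'].
  exists (Rmin r r'); split; [apply Rmin_pos; [exact Hr | apply cond_pos] |].
  intros x Hx; pose proof (Rmin_l r r'); pose proof (Rmin_r r r').
  assert (Hxr : Rabs x < r) by (rewrite Rabs_pos_eq; lra).
  assert (H1 : 0 < rho A B C x).
  { rewrite <- rho_0; apply rho_increasing; rewrite ?Rabs_R0; lra. }
  assert (H2 : rho A B C x < eta).
  { assert (H2 : Rabs (rho A B C x - rho A B C 0) < eta).
    { apply Hr'; change (Rabs (x - 0) < r').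
      rewrite Rminus_0_r, Rabs_pos_eq; lra. }
    rewrite rho_0 in H2; apply Rabs_def2 in H2; lra. }
  split; [lra |].
  assert (Hd : Rabs (rho A B C x) < d) by (rewrite Rabs_pos_eq; lra).
  pose proof (rho_X _ Hd) as E; destruct (HX _ Hd) as [_ Hb].
  destruct (Rtotal_order (X (rho A B C x)) x) as [H'|[H'|H']]; [| exact H' |];
    apply rho_increasing in H'; auto; lra.
Qed.

End LocalInverse.

(** * Integration along a characteristic *)

Section Characteristic.
Context (A B C alpha0 beta0 gamma0 : R) (X : R -> R) (d K s : R).
Let delta := beta0 - C.
Let nu := delta / C.
Let Fnu := F A B alpha0 gamma0 nu X.
Let Lnu := L A B alpha0 gamma0 nu delta X.
Let w := motzkin_weight A B C alpha0 beta0 gamma0.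
Context (hC : 0 < C) (hdelta : 0 < delta) (X0 : X 0 = 0).
Context (HX : forall tau, Rabs tau < d ->
     is_derive X tau (Q A B C (X tau)) /\ Rabs (X tau) <= 1 / 2).
Context (Xpos : forall tau, 0 < tau < d -> 0 < X tau).
Context (HK : 0 < K) (Hw : growth K w).
Context (Hd : K * d <= 1 / 8) (Hs : K * Rabs s <= 1 / 8).

Let drift r := (alpha0 - nu * A) * X r + gamma0 - nu * B.

Lemma drift_integral_derive tau :
  Rabs tau < d -> is_derive (RInt drift 0) tau (drift tau).
Proof.
  intros Ht; pose proof (Rabs_pos tau); apply Rabs_def2 in Ht.
  apply (is_derive_RInt_right _ (- d) d); try lra.
  intros z Hz; destruct (HX z) as [H1 _]; [apply Rabs_def1; lra |].
  apply (ex_derive_continuous (V := R_NormedModule)); unfold drift.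
  auto_derive; eexists; exact H1.
Qed.

Lemma F_pos tau : 0 < Fnu tau.
Proof. apply Rmult_lt_0_compat; apply exp_pos. Qed.

(** The term [nu X' / X = nu Q(X) / X] equals [nu A X + nu B + delta / X], and
    the exponential factor of [F_nu] is chosen to cancel the terms
    [nu A X] and [nu B]. *)
Lemma F_derive tau :
  0 < tau < d ->
  is_derive Fnu tau (Fnu tau * (delta / X tau + alpha0 * X tau + gamma0)).
Proof.
  intros Ht; assert (Ha : Rabs tau < d) by (rewrite Rabs_pos_eq; lra).
  destruct (HX tau Ha) as [H1 _]; pose proof (Xpos tau Ht) as H2.
  pose proof (drift_integral_derive tau Ha) as H3.
  unfold Fnu, F, Rpower; change (fun r => _ + _ - _) with drift.
  change (is_derive (fun t => exp (nu * ln (X t)) * exp (RInt drift 0 t)) tau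
    (exp (nu * ln (X tau)) * exp (RInt drift 0 tau) *
       (delta / X tau + alpha0 * X tau + gamma0))).
  set (I := RInt drift 0) in *.
  auto_derive.
  - repeat split; auto; eexists; eassumption.
  - change (fun x => X x) with X; change (fun x => I x) with I.
    rewrite (is_derive_unique _ _ _ H1), (is_derive_unique _ _ _ H3).
    unfold drift, Q, nu; field; split; lra.
Qed.

(** As [beta0 > C], the exponent [nu] is positive, so the power [X^nu] tends to
    [0], while the exponential tends to [1]. *)
Lemma F_right_0 : 0 < d -> filterlim Fnu (at_right 0) (locally 0).
Proof.
  intros Hd0; assert (Hnu : 0 < nu) by (apply Rdiv_lt_0_compat; assumption).
  assert (Ha : Rabs 0 < d) by (rewrite Rabs_R0; lra).
  replace 0 with (0 * exp (RInt drift 0 0)) at 2 by ring.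
  apply (filterlim_comp_2 (F := at_right 0)
    (fun t => Rpower (X t) nu) (fun t => exp (RInt drift 0 t)) Rmult
    (G := locally 0) (H := locally (exp (RInt drift 0 0)))).
  - apply filterlim_locally; intros eps.
    set (b := Rpower eps (/ nu)).
    assert (Hc : continuous X 0)
      by (apply (ex_derive_continuous (V := R_NormedModule)); eexists;
          apply HX, Ha).
    destruct (proj1 (filterlim_locally _ _) Hc (mkposreal b (exp_pos _)))
      as [e He].
    apply (at_right_intro 0 (Rmin d e));
      [apply Rmin_pos; [assumption | apply cond_pos] |].
    intros t Ht; pose proof (Rmin_l d e); pose proof (Rmin_r d e).
    assert (Hp : 0 < X t) by (apply Xpos; lra).
    assert (Hb : Rabs (X t - X 0) < b).
    { apply He; change (Rabs (t - 0) < e).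
      rewrite Rminus_0_r, Rabs_pos_eq; lra. }
    rewrite X0, Rminus_0_r, Rabs_pos_eq in Hb by lra.
    change (Rabs (Rpower (X t) nu - 0) < eps).
    rewrite Rminus_0_r, Rabs_pos_eq by (apply Rlt_le, exp_pos).
    replace (pos eps) with (Rpower b nu).
    + apply Rlt_Rpower_l; [assumption | split; assumption].
    + unfold b; rewrite Rpower_mult, Rinv_l, Rpower_1;
        [reflexivity | apply cond_pos | lra].
  - apply (filterlim_filter_le_1 (F := locally 0)); [apply filter_le_within |].
    apply (ex_derive_continuous (V := R_NormedModule)
      (fun t => exp (RInt drift 0 t))).
    pose proof (drift_integral_derive 0 Ha) as H3.
    set (I := RInt drift 0) in *.
    auto_derive; eexists; exact H3.
  - apply (filterlim_mult (K := R_AbsRing)).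
Qed.

Lemma time_small v : 0 < v < d -> K * Rabs (s - v) <= 1 / 4.
Proof.
  intros Hv; assert (Rabs (s - v) <= Rabs s + Rabs v)
    by (unfold Rminus; rewrite <- (Rabs_Ropp v); apply Rabs_triang).
  rewrite (Rabs_pos_eq v) in H by lra; nra.
Qed.

Let mode n t := (s - t) ^ n / INR (fact n).
Let approx N t :=
  sum_f_R0 (fun n => Fnu t * (PSeries (w n) (X t) * mode n t)) N.

Lemma mode_derive n t :
  is_derive (mode n) t (match n with O => 0 | S m => - mode m t end).
Proof.
  unfold mode; destruct n as [|m]; [auto_derive; [trivial | simpl; field] |].
  rewrite fact_simpl, mult_INR.
  pose proof (INR_fact_neq_0 m); pose proof (not_0_INR (S m) (Nat.neq_succ_0 m)).
  set (c := INR (fact m)) in *; set (k := INR (S m)) in *.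
  auto_derive; [trivial |].
  change (match m with O => 1 | S _ => INR m + 1 end) with k.
  change (s + - t) with (s - t); field; auto.
Qed.

(** The row recurrence and the equation for [F_nu] replace the [x]-derivative of
    the [n]-th term by the next row; the time derivative brings in mode
    [n - 1] with the opposite sign, which cancels against the previous term. *)
Lemma mode_term_derive n t :
  0 < t < d ->
  is_derive (fun t => Fnu t * (PSeries (w n) (X t) * mode n t)) t
    (Fnu t * PSeries (w (S n)) (X t) * mode n t
     - match n with
       | O => 0
       | S m => Fnu t * PSeries (w n) (X t) * mode m t
       end
     + Lnu t * (w n 0%nat * mode n t)).
Proof.
  intros Ht; assert (Ha : Rabs t < d) by (rewrite Rabs_pos_eq; lra).
  destruct (HX t Ha) as [H1 H2]; pose proof (Xpos t Ht) as H3.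
  assert (Hcv := row_CV_radius_growth K w n (X t) Hw H2).
  assert (Hg := is_derive_PSeries _ _ Hcv).
  assert (Hp := mode_derive n t).
  assert (HF := F_derive t Ht).
  assert (Hrow := motzkin_row_succ A B C alpha0 beta0 gamma0 n (X t)).
  fold w delta in Hrow; rewrite Hrow by (assumption || lra).
  clear Hrow.
  set (g := PSeries (w n)) in *; set (g' := PSeries (PS_derive (w n))) in *.
  set (p := mode n) in *.
  auto_derive.
  - repeat split; eexists; eassumption.
  - change (fun x => X x) with X; change (fun x => g x) with g;
      change (fun x => p x) with p; change (fun x => Fnu x) with Fnu.
    rewrite (is_derive_unique _ _ _ H1), (is_derive_unique _ _ _ Hg),
      (is_derive_unique _ _ _ Hp), (is_derive_unique _ _ _ HF).
    unfold Lnu, L; fold Fnu.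
    destruct n; field; lra.
Qed.

Lemma approx_derive N t :
  0 < t < d ->
  is_derive (approx N) t
    (Fnu t * PSeries (w (S N)) (X t) * mode N t
     + Lnu t * sum_f_R0 (fun n => w n 0%nat * mode n t) N).
Proof.
  intros Ht; induction N as [|N IH].
  - unfold approx; simpl sum_f_R0.
    replace (Fnu t * _ * _ + _) with
      (Fnu t * PSeries (w 1%nat) (X t) * mode 0 t - 0
       + Lnu t * (w 0%nat 0%nat * mode 0 t)) by ring.
    apply (mode_term_derive 0 t Ht).
  - replace (_ + _) with
      (plus
        (Fnu t * PSeries (w (S N)) (X t) * mode N t
         + Lnu t * sum_f_R0 (fun n => w n 0%nat * mode n t) N)
        (Fnu t * PSeries (w (S (S N))) (X t) * mode (S N) t
         - Fnu t * PSeries (w (S N)) (X t) * mode N t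
         + Lnu t * (w (S N) 0%nat * mode (S N) t)))
      by (unfold plus; simpl; ring).
    apply (is_derive_plus (V := R_NormedModule) (approx N) _ t _ _ IH
      (mode_term_derive (S N) t Ht)).
Qed.

Lemma L_continuous t : 0 < t < d -> continuous Lnu t.
Proof.
  intros Ht; assert (Ha : Rabs t < d) by (rewrite Rabs_pos_eq; lra).
  destruct (HX t Ha) as [H1 _]; pose proof (Xpos t Ht) as H2.
  pose proof (F_derive t Ht) as HF.
  apply (ex_derive_continuous (V := R_NormedModule)); unfold Lnu, L; fold Fnu.
  auto_derive; repeat split; try lra; eexists; eassumption.
Qed.

Lemma L_pos t : 0 < t < d -> 0 < Lnu t.
Proof.
  intros Ht; apply Rdiv_lt_0_compat; [| apply Xpos; assumption].
  apply Rmult_lt_0_compat; [assumption | apply F_pos].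
Qed.

Lemma return_gf_continuous v :
  0 < v < d -> continuous (fun v => gf w 0 (s - v)) v.
Proof.
  intros Hv; pose proof (time_small v Hv).
  apply (continuous_comp (fun v => s - v) (gf w 0)).
  - apply (ex_derive_continuous (V := R_NormedModule)); auto_derive; auto.
  - apply (gf_continuous_t K); try assumption; rewrite ?Rabs_R0; lra.
Qed.

(** The ratio of the factorials in [g_{N+1}(X) (s - t)^N / N!] leaves a factor
    [N + 1], absorbed by relaxing the ratio from [1/4] to [1/2]. *)
Lemma succ_mul_quarter_pow N q :
  0 <= q <= 1 / 4 -> INR (S N) * q ^ N <= (1 / 2) ^ N.
Proof.
  intros Hq; assert (H : INR (S N) <= 2 ^ N).
  { induction N as [|N IH]; [simpl; lra |].
    rewrite S_INR; simpl pow; assert (1 <= 2 ^ N) by (apply pow_R1_Rle; lra).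
    lra. }
  replace ((1 / 2) ^ N) with (2 ^ N * (1 / 4) ^ N)
    by (rewrite <- Rpow_mult_distr; f_equal; field).
  apply Rmult_le_compat; [apply pos_INR | apply pow_le; lra | exact H
    | apply pow_incr; exact Hq].
Qed.

Lemma remainder_bound N t :
  0 < t < d ->
  Rabs (PSeries (w (S N)) (X t) * mode N t) <= 2 * K * (1 / 2) ^ N.
Proof.
  intros Ht; assert (Ha : Rabs t < d) by (rewrite Rabs_pos_eq; lra).
  destruct (HX t Ha) as [_ H2]; pose proof (time_small t Ht) as H3.
  pose proof (INR_fact_lt_0 N); pose proof (Rabs_pos (s - t)).
  eapply Rle_trans.
  - apply Rabs_mult_le; [apply (row_PSeries_bound K); assumption |].
    apply Req_le; unfold mode, Rdiv.
    rewrite Rabs_mult, <- RPow_abs, (Rabs_pos_eq (/ _))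
      by (apply Rlt_le, Rinv_0_lt_compat; assumption); reflexivity.
  - replace (2 * (K ^ S N * INR (fact (S N))) *
      (Rabs (s - t) ^ N * / INR (fact N)))
      with (2 * K * (INR (S N) * (K * Rabs (s - t)) ^ N))
      by (rewrite Rpow_mult_distr, fact_simpl, mult_INR; simpl pow; field; lra).
    apply Rmult_le_compat_l; [lra |].
    apply succ_mul_quarter_pow; split; [nra | assumption].
Qed.

Lemma return_tail N t :
  0 < t < d ->
  Rabs (sum_f_R0 (fun n => w n 0%nat * mode n t) N - gf w 0 (s - t)) <=
    4 * (1 / 2) ^ N.
Proof.
  intros Ht; pose proof (time_small t Ht) as H3.
  rewrite Rabs_minus_sym, gf_PSeries.
  rewrite (sum_eq _ (fun n => PSeries (w n) 0 / INR (fact n) * (s - t) ^ n)).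
  - eapply Rle_trans; [apply (PSeries_tail _ 2 K); try lra |].
    + intros n; apply column_growth; [assumption | rewrite Rabs_R0; lra].
    + simpl pow; pose proof (pow_lt (1 / 2) N); lra.
  - intros n _; rewrite PSeries_0; unfold mode, Rdiv; ring.
Qed.

Lemma approx_limit t :
  0 < t < d ->
  is_lim_seq (fun N => approx N t) (Fnu t * gf w (X t) (s - t)).
Proof.
  intros Ht; assert (Ha : Rabs t < d) by (rewrite Rabs_pos_eq; lra).
  destruct (HX t Ha) as [_ H2]; pose proof (time_small t Ht) as H3.
  rewrite gf_PSeries.
  assert (Hcv : ex_pseries (fun n => PSeries (w n) (X t) / INR (fact n)) (s - t)).
  { apply CV_radius_inside, (growth_CV_radius _ 2 K); try lra.
    intros n; apply column_growth; assumption. }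
  apply PSeries_correct in Hcv; apply is_pseries_R in Hcv.
  apply (is_lim_seq_ext (fun N => Fnu t *
    sum_n (fun n => PSeries (w n) (X t) / INR (fact n) * (s - t) ^ n) N));
    [intros N | exact (is_lim_seq_scal_l _ (Fnu t) (Finite _) Hcv)].
  unfold approx; rewrite <- sum_n_Reals, <- (sum_n_mult_l (K := R_Ring)).
  apply sum_n_ext; intros n; unfold mode, mult; simpl; unfold Rdiv; ring.
Qed.

Lemma continuous_bounded_above (f : R -> R) (a b : R) :
  a <= b -> (forall x, a <= x <= b -> continuous f x) ->
  exists M, forall x, a <= x <= b -> f x <= M.
Proof.
  intros Hab Hf; destruct (continuity_ab_maj f a b Hab) as [m [Hm _]].
  - intros x Hx; apply continuity_pt_filterlim, Hf, Hx.
  - exists (f m); exact Hm.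
Qed.

Lemma characteristic_integral a b :
  0 < a -> a <= b -> b < d ->
  is_RInt (fun v => Lnu v * gf w 0 (s - v)) a b
    (Fnu b * gf w (X b) (s - b) - Fnu a * gf w (X a) (s - a)).
Proof.
  intros Ha Hab Hb.
  destruct (continuous_bounded_above Fnu a b Hab) as [MF HMF].
  { intros x Hx; apply (ex_derive_continuous (V := R_NormedModule)); eexists.
    apply F_derive; lra. }
  destruct (continuous_bounded_above Lnu a b Hab) as [ML HML].
  { intros x Hx; apply L_continuous; lra. }
  apply (is_RInt_limit_of_derivatives 0 d a b approx
    (fun N t => Fnu t * PSeries (w (S N)) (X t) * mode N t
       + Lnu t * sum_f_R0 (fun n => w n 0%nat * mode n t) N)
    (fun t => Fnu t * gf w (X t) (s - t)) _
    (fun N => (MF * (2 * K) + ML * 4) * (1 / 2) ^ N)); try lra.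
  - intros; apply approx_derive; assumption.
  - intros N x Hx; assert (Hx' : 0 < x < d) by lra.
    pose proof (F_pos x); pose proof (L_pos x Hx').
    replace (_ - _) with
      (Fnu x * (PSeries (w (S N)) (X x) * mode N x) +
       Lnu x * (sum_f_R0 (fun n => w n 0%nat * mode n x) N - gf w 0 (s - x)))
      by ring.
    rewrite Rmult_plus_distr_r, !Rmult_assoc.
    eapply Rle_trans; [apply Rabs_triang |]; apply Rplus_le_compat;
      (apply Rabs_mult_le; [rewrite Rabs_pos_eq by lra; auto |]).
    + rewrite <- Rmult_assoc; apply remainder_bound; assumption.
    + apply return_tail; assumption.
  - intros x Hx; apply approx_limit; lra.
  - replace (Finite 0) with (Rbar_mult (MF * (2 * K) + ML * 4) 0)
      by (simpl; f_equal; ring).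
    apply is_lim_seq_scal_l, is_lim_seq_geom; rewrite Rabs_pos_eq; lra.
  - intros x Hx; apply (continuous_mult (K := R_AbsRing));
      [apply L_continuous | apply return_gf_continuous]; assumption.
Qed.

(** The contribution of the lower endpoint is [F_nu(a)] times a bounded factor,
    and vanishes as [a] tends to [0+]. *)
Lemma characteristic_integral_from_0 tau :
  0 < tau < d ->
  is_RInt_gen (fun v => Lnu v * gf w 0 (s - v)) (at_right 0) (at_point tau)
    (Fnu tau * gf w (X tau) (s - tau)).
Proof.
  intros Ht P [eps HP].
  assert (He := cond_pos eps); assert (He4 : 0 < eps / 4) by lra.
  apply (Filter_prod _ _ _ (fun a => 0 < a < tau /\ Fnu a < eps / 4)
    (fun b => b = tau)).
  - apply filter_and.
    + apply (at_right_intro 0 tau); [lra | intros; lra].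
    + assert (Hd0 : 0 < d) by lra.
      assert (H := proj1 (filterlim_locally _ _) (F_right_0 Hd0)
        (mkposreal _ He4)).
      revert H; apply filter_imp; intros a H.
      change (Rabs (Fnu a - 0) < eps / 4) in H.
      apply Rabs_def2 in H; lra.
  - reflexivity.
  - intros a b [Ha1 Ha2] ->; simpl.
    exists (Fnu tau * gf w (X tau) (s - tau) - Fnu a * gf w (X a) (s - a)).
    split; [apply characteristic_integral; lra |].
    apply HP.
    assert (Hb : Rabs (gf w (X a) (s - a)) <= 4).
    { assert (Ha : Rabs a < d) by (rewrite Rabs_pos_eq; lra).
      assert (K * Rabs (s - a) <= 1 / 4) by (apply time_small; lra).
      apply (gf_bound K); try lra; [assumption | apply HX, Ha]. }
    change (Rabs (Fnu tau * gf w (X tau) (s - tau) -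
      Fnu a * gf w (X a) (s - a) - Fnu tau * gf w (X tau) (s - tau)) < eps).
    replace (_ - _ - _) with (- (Fnu a * gf w (X a) (s - a))) by ring.
    pose proof (F_pos a).
    rewrite Rabs_Ropp, Rabs_mult, (Rabs_pos_eq (Fnu a)) by lra.
    pose proof (Rabs_pos (gf w (X a) (s - a))); nra.
Qed.

End Characteristic.

(** * The convolution formula *)

Lemma egf_returns u t : egf (fun n => u n 0%nat) t = gf u 0 t.
Proof.
  rewrite gf_PSeries; unfold egf, PSeries at 1; apply Series_ext; intros n.
  rewrite PSeries_0; unfold Rdiv; ring.
Qed.

Lemma solution_near_0 A B C X r :
  0 < r -> solves_near_0 A B C X ->
  exists d, 0 < d /\ forall tau, Rabs tau < d ->
    is_derive X tau (Q A B C (X tau)) /\ Rabs (X tau) < r.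
Proof.
  intros Hr [X0 HX].
  assert (Hc : continuous X 0).
  { apply (ex_derive_continuous (V := R_NormedModule)); eexists.
    exact (locally_singleton _ _ HX). }
  assert (Hb := proj1 (filterlim_locally _ _) Hc (mkposreal r Hr)).
  destruct (filter_and _ _ HX Hb) as [d Hd].
  exists d; split; [apply cond_pos |]; intros tau Htau.
  destruct (Hd tau) as [H1 H2].
  - change (Rabs (tau - 0) < d); now rewrite Rminus_0_r.
  - split; [exact H1 |].
    change (Rabs (X tau - X 0) < r) in H2; now rewrite X0, Rminus_0_r in H2.
Qed.

Lemma growth_analytic K u : 0 < K -> growth K u -> analytic_at_origin u.
Proof.
  intros HK Hu.
  assert (HK' : 0 < 1 / 2 / K) by (apply Rdiv_lt_0_compat; lra).
  assert (Hr : 0 < Rmin (1 / 2) (1 / 2 / K)) by (apply Rmin_pos; lra).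
  exists (mkposreal _ Hr); intros x t Hx Ht; simpl in Hx, Ht.
  pose proof (Rmin_l (1 / 2) (1 / 2 / K)).
  pose proof (Rmin_r (1 / 2) (1 / 2 / K)).
  apply (growth_abs_summable K); try lra; [assumption |].
  replace (1 / 2) with (K * (1 / 2 / K)) by (field; lra).
  apply Rmult_le_compat_l; lra.
Qed.

Theorem theorem2p2 (A B C alpha0 beta0 gamma0 : R) (X : R -> R)
  (hC : 0 < C) (hbeta : C < beta0) (hX : solves_near_0 A B C X) :
  let delta := beta0 - C in
  let nu := (beta0 - C) / C in
  let Fnu := F A B alpha0 gamma0 nu X in
  let Lnu := L A B alpha0 gamma0 nu delta X in
  let rho := rho A B C in
  let w := motzkin_weight A B C alpha0 beta0 gamma0 in
  let W := fun t => gf w 0 t in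
  let rhs := fun V x t => / Fnu (rho x) * convolution Lnu V (rho x) t in
  analytic_at_origin w /\
  (exists r : posreal,
     (forall x t : R, 0 < x < r -> Rabs t < r ->
        convolution_converges Lnu W (rho x) t /\ gf w x t = rhs W x t) /\
     (forall t : R, Rabs t < r ->
        filterlim (fun p : R * R => rhs W (fst p) (snd p))
          (filter_prod (at_right 0) (locally t)) (locally (W t)))) /\
  (forall u : nat -> nat -> R,
     analytic_at_origin u ->
     (exists r : posreal, forall x t : R, 0 < x < r -> Rabs t < r ->
        gf u x t = rhs (egf (fun n => w n 0%nat)) x t) ->
     forall n k : nat, u n k = w n k).
Proof.
  intros delta nu Fnu Lnu rho w W rhs.
  pose (M := Rabs A + Rabs B + Rabs C + Rabs alpha0 + Rabs beta0 + Rabs gamma0).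
  pose (K := 3 * M).
  pose proof (Rabs_pos A); pose proof (Rabs_pos B); pose proof (Rabs_pos alpha0);
    pose proof (Rabs_pos beta0); pose proof (Rabs_pos gamma0).
  assert (HCpos : 0 < Rabs C) by (rewrite Rabs_pos_eq; lra).
  assert (HK : 0 < K) by (unfold K, M; lra).
  assert (Hw : growth K w) by (apply motzkin_growth; unfold M; lra).
  assert (Hana : analytic_at_origin w) by exact (growth_analytic K w HK Hw).
  assert (Hmain : exists r : posreal, K * r <= 1 / 16 /\
    forall x t : R, 0 < x < r -> Rabs t < r ->
      convolution_converges Lnu W (rho x) t /\ gf w x t = rhs W x t).
  { destruct (Q_pos_near_0 A B C hC) as [r0 [Hr0 HQ]].
    pose (r1 := Rmin r0 (1 / 2)).
    assert (Hr1 : 0 < r1) by (apply Rmin_pos; lra).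
    assert (Hr10 : r1 <= r0) by apply Rmin_l.
    assert (Hr12 : r1 <= 1 / 2) by apply Rmin_r.
    assert (HQ1 : forall y, Rabs y < r1 -> 0 < Q A B C y)
      by (intros; apply HQ; lra).
    destruct (solution_near_0 A B C X r1 Hr1 hX) as [d0 [Hd0 HX0]].
    (* |t| and rho(x) are kept below 1 / (16 K), so that K |t + rho(x) - v| is
       at most 1/4 along the whole characteristic *)
    assert (exists e, 0 < e /\ K * e = 1 / 16) as [e [He EK]].
    { exists (1 / 16 / K); split; [apply Rdiv_lt_0_compat; lra | field; lra]. }
    pose (d := Rmin d0 e).
    assert (Hd : 0 < d) by (apply Rmin_pos; lra).
    assert (Hdd0 : d <= d0) by apply Rmin_l.
    assert (HdK : d <= e) by apply Rmin_r.
    assert (HKd : K * d <= 1 / 16)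
      by (rewrite <- EK; apply Rmult_le_compat_l; lra).
    assert (HX : forall tau, Rabs tau < d ->
      is_derive X tau (Q A B C (X tau)) /\ Rabs (X tau) < r1)
      by (intros; apply HX0; lra).
    destruct hX as [X0 _].
    destruct (X_rho A B C r1 HQ1 X d X0 HX d Hr1 (conj Hd (Rle_refl d)))
      as [r2 [Hr2 Hrho]].
    assert (Hr : 0 < Rmin r2 e) by (apply Rmin_pos; lra).
    exists (mkposreal _ Hr); simpl.
    pose proof (Rmin_l r2 e); pose proof (Rmin_r r2 e).
    split; [rewrite <- EK; apply Rmult_le_compat_l; lra |].
    intros x t Hx Ht.
    destruct (Hrho x) as [Htau EX]; [lra |].
    fold rho in Htau, EX.
    assert (HKs : K * Rabs (t + rho x) <= 1 / 8).
    { assert (Rabs (t + rho x) <= Rabs t + rho x)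
        by (rewrite <- (Rabs_pos_eq (rho x)) at 2 by lra; apply Rabs_triang).
      assert (K * Rabs t <= 1 / 16)
        by (rewrite <- EK; apply Rmult_le_compat_l; lra).
      assert (K * rho x <= 1 / 16)
        by (rewrite <- EK; apply Rmult_le_compat_l; lra).
      nra. }
    assert (HI : is_RInt_gen (fun v => Lnu v * W (t + rho x - v))
      (at_right 0) (at_point (rho x)) (Fnu (rho x) * gf w x t)).
    { replace (gf w x t) with (gf w (X (rho x)) (t + rho x - rho x))
        by (f_equal; [exact EX | ring]).
      apply (characteristic_integral_from_0 A B C alpha0 beta0 gamma0 X d K);
        try assumption; try lra.
      - intros tau Htau'; split; [apply HX; assumption |].
        apply Rlt_le, Rlt_le_trans with r1; [apply HX |]; assumption.
      - apply (X_pos A B C r1 HQ1 X d X0 HX). }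
    split; [eexists; exact HI |].
    unfold rhs, convolution.
    rewrite (is_RInt_gen_unique (V := R_CompleteNormedModule) _ _ HI).
    pose proof (F_pos A B C alpha0 beta0 gamma0 X (rho x)) as HF.
    change (0 < Fnu (rho x)) in HF; field; lra. }
  destruct Hmain as [r [HKr Hmain]]; pose proof (cond_pos r) as Hr.
  split; [exact Hana | split].
  - exists r; split; [exact Hmain |]; intros t Ht.
    assert (HKt : K * Rabs t <= K * r) by (apply Rmult_le_compat_l; lra).
    apply (filterlim_ext_loc (fun p : R * R => gf w (fst p) (snd p))).
    + apply (Filter_prod _ _ _ (fun x => 0 < x < r) (fun s => Rabs s < r)).
      * apply (at_right_intro 0 r); [assumption | intros; lra].
      * apply (locally_Rabs t (r - Rabs t)); [lra |]; intros s Hs.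
        replace s with ((s - t) + t) by ring.
        eapply Rle_lt_trans; [apply Rabs_triang | lra].
      * intros x s Hx Hs; apply Hmain; assumption.
    + apply (gf_limit_x K); try assumption; lra.
  - intros u [ru Hu] [re He].
    destruct Hana as [rw Hrw].
    pose proof (cond_pos ru); pose proof (cond_pos re); pose proof (cond_pos rw).
    pose (m := Rmin (Rmin ru rw) (Rmin re r)).
    assert (m <= ru /\ m <= rw /\ m <= re /\ m <= r /\ 0 < m) as Hm.
    { unfold m; repeat split;
        [ eapply Rle_trans; [apply Rmin_l | apply Rmin_l]
        | eapply Rle_trans; [apply Rmin_l | apply Rmin_r]
        | eapply Rle_trans; [apply Rmin_r | apply Rmin_l]
        | eapply Rle_trans; [apply Rmin_r | apply Rmin_r]
        | repeat apply Rmin_pos; assumption ]. }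
    destruct Hm as (Hm1 & Hm2 & Hm3 & Hm4 & Hm5).
    apply (gf_determines_coefficients u w m Hm5).
    + intros; apply Hu; lra.
    + intros; apply Hrw; lra.
    + intros x t Hx Ht; rewrite He by lra.
      replace (egf (fun n => w n 0%nat)) with W
        by (apply functional_extensionality; intros; symmetry; apply egf_returns).
      symmetry; apply Hmain; lra.
Qed.
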